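(* Let $G$ be a compact Hausdorff group, let $E$ be a complex Banach space, let $(\gamma(\sigma))_{\sigma\in\widehat{G}}$ be a family of nonnegative real numbers, and let $s,t\in[0,\infty)$. If $t>s$, then $H_\gamma^t(G,E)$ is continuously embedded in $H_\gamma^s(G,E)$, with $\|f\|_{H_\gamma^s}\leq\|f\|_{H_\gamma^t}$ for all $f\in H_\gamma^t(G,E)$.
   Context: $G$ is a compact Hausdorff group (not necessarily abelian), and $dx$ is its normalized Haar measure. $\widehat{G}$ denotes the unitary dual of $G$, the set of equivalence classes of continuous irreducible unitary representations of $G$. For each $\sigma\in\widehat{G}$ a representative, also denoted $\sigma$, is fixed, acting on a Hilbert space $H_\sigma$ of finite dimension $d_\sigma$ with inner product $\langle\cdot,\cdot\rangle_\sigma$ (linear in the first variable), and an orthonormal basis $\{\xi_1^\sigma,\dots,\xi_{d_\sigma}^\sigma\}$ of $H_\sigma$ is fixed. $L^2(G,E)$ is the space of $E$-valued Bochner square integrable functions on $G$ (modulo a.e. equality). For $f\in L^2(G,E)$ and $\sigma\in\widehat{G}$, the Fourier transform $\widehat{f}(\sigma)$ is the $E$-valued sesquilinear map on $H_\sigma\times H_\sigma$ given by $\widehat{f}(\sigma)(\xi,\eta)=\int_G\langle\sigma(x)^*\xi,\eta\rangle_\sigma f(x)\,dx$. For $s\in[0,\infty)$, the Sobolev space $H_\gamma^s(G,E)$ is the subspace of all $f\in L^2(G,E)$ such that $$\|f\|_{H_\gamma^s}:=\left(\sum_{\sigma\in\widehat{G}}d_\sigma(1+\gamma(\sigma)^2)^s\sum_{i=1}^{d_\sigma}\sum_{j=1}^{d_\sigma}\|\widehat{f}(\sigma)(\xi_j^\sigma,\xi_i^\sigma)\|_E^2\right)^{1/2}<\infty.$$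 *)

(* Defs.v *)
From HB Require Import structures.
From mathcomp Require Import all_boot all_order all_algebra ring.
From mathcomp Require Import sesquilinear generic_quotient ring_quotient complex.
From mathcomp Require Import all_classical all_reals all_analysis.
From mathcomp Require Import measurable_realfun.

Set Implicit Arguments.
Unset Strict Implicit.
Unset Printing Implicit Defensive.
Import Order.TTheory GRing.Theory Num.Theory.
Import numFieldNormedType.Exports.
Local Open Scope classical_set_scope.
Local Open Scope ring_scope.
Local Open Scope complex_scope.

HB.mixin Record isTopologicalGroup G & Topological G & Group G := {
  mulg_continuous : continuous (fun p : G * G => (p.1 * p.2)%g) ;
  invg_continuous : continuous (fun x : G => (x^-1)%g)
}.

#[short(type="topologicalGroupType")]
HB.structure Definition TopologicalGroup :=
  {G of Topological G & Group G & isTopologicalGroup G}.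

(* [g_sigma_algebraType] wants a pointed type; the neutral element serves. *)
Definition pointed_group (G : topologicalGroupType) : Type := G.
HB.instance Definition _ (G : topologicalGroupType) :=
  Choice.on (pointed_group G).
HB.instance Definition _ (G : topologicalGroupType) :=
  isPointed.Build (pointed_group G) (1%g : G).

Definition borel (G : topologicalGroupType) : measurableType _ :=
  g_sigma_algebraType (@open G : set (set (pointed_group G))).

(* left-invariant and regular; the normalization is in [probability] *)
Definition is_haar (R : realType) (G : topologicalGroupType)
    (mu : probability (borel G) R) :=
  [/\ forall (x : G) (A : set G), measurable (A : set (borel G)) ->
        mu ((fun y => (x * y)%g) @` A) = mu A,
      forall A : set G, measurable (A : set (borel G)) ->
        mu A = ereal_inf [set mu U | U in [set U : set G | open U /\ A `<=` U]]
    & forall U : set G, open U ->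
        mu U = ereal_sup
          [set mu K | K in [set K : set G | compact K /\ K `<=` U]]].

Section representations.
Variables (R : realType) (G : topologicalGroupType).

Definition hnorm (H : vectType R[i]) (dot : {dot H for Num.conj}) (v : H) : R :=
  Num.sqrt (complex.Re (dot v v)).

(* Finite-dimensional, as is every irreducible unitary representation of a
   compact group. Unitarity: [rep_op x] is isometric, and invertible since
   [rep_op] is a morphism. Continuity is strong continuity. *)
Record unirrep := UniRrep {
  rep_space : vectType R[i] ;
  rep_dot : {dot rep_space for Num.conj} ;
  rep_op :> G -> 'End(rep_space) ;
  rep_op1 : rep_op 1%g = \1%VF ;
  rep_opM : forall x y, rep_op (x * y)%g = (rep_op x \o rep_op y)%VF ;
  rep_unitary : forall x, isometry rep_dot rep_dot (rep_op x) ;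
  rep_continuous : forall (v : rep_space) (x : G),
    hnorm rep_dot (rep_op y v - rep_op x v) @[y --> x] --> (0 : R) ;
  rep_nontrivial : (fullv : {vspace rep_space}) != 0%VS ;
  rep_irreducible : forall W : {vspace rep_space},
    (forall x, (rep_op x @: W <= W)%VS) -> W = 0%VS \/ W = fullv
}.

Definition rep_dim (rho : unirrep) : nat := \dim {: rep_space rho}.

Definition rep_equiv (rho tau : unirrep) :=
  exists T : 'Hom(rep_space rho, rep_space tau),
    [/\ bijective T, isometry (rep_dot tau) (rep_dot rho) T
      & forall x, (T \o rho x = tau x \o T)%VF].

(* The set of equivalence classes of [unirrep]s with a fixed representative of
   each class: a family [dual_rep] that meets every class exactly once. Classes
   are named by an abstract [dual_class] because the sets of [unirrep]s, a type
   that quantifies over all Hilbert spaces, live in too large a universe to be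
   the elements of a [choiceType]. *)
Record unitary_dual := UnitaryDual {
  dual_class :> choiceType ;
  dual_rep : dual_class -> unirrep ;
  dual_rep_inj : forall s t,
    rep_equiv (dual_rep s) (dual_rep t) -> s = t ;
  dual_rep_surj : forall rho, exists s, rep_equiv (dual_rep s) rho
}.

Definition adjoint (H : vectType R[i]) (dot : {dot H for Num.conj})
    (A : 'End(H)) : 'End(H) :=
  xget 0 [set B : 'End(H) | forall u v, dot (B u) v = dot u (A v)].

Lemma adjoint_unirrep (rho : unirrep) (x : G) :
  adjoint (rep_dot rho) (rho x) = rho (x^-1)%g.
Proof.
have opVK : (rho x \o rho (x^-1)%g)%VF = \1%VF.
  by rewrite -rep_opM mulgV rep_op1.
apply: xget_unique => [u v|B BP] /=.
  rewrite -(@rep_unitary rho x (rho (x^-1)%g u) v).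
  by rewrite -[rho x (rho _ u)]comp_lfunE opVK id_lfunE.
apply/lfunP => u; apply/eqP; rewrite -subr_eq0; apply/eqP.
set w := _ - _.
have w0 v : rep_dot rho w v = 0.
  rewrite /w linearBl /= BP -(@rep_unitary rho x (rho (x^-1)%g u) v).
  by rewrite -[rho x (rho _ u)]comp_lfunE opVK id_lfunE subrr.
apply/eqP; apply: contraT => /(@neq0_dnorm_gt0 _ _ _ (rep_dot rho)).
by rewrite w0 ltxx.
Qed.

End representations.

(* [`|v|] takes its values in [R[i]], the scalar field of [E]; [rnorm v] is the
   same number seen in [R]. *)
Section real_norm.
Variables (R : realType) (E : normedModType R[i]).

Definition rnorm (v : E) : R := complex.Re `|v|.

Lemma rnormE (v : E) : (rnorm v)%:C = `|v|.
Proof.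
rewrite /rnorm; have /ger0_Im : 0 <= `|v| by [].
by case: (`|v|) => a b /= ->.
Qed.

Lemma rnorm_ge0 v : 0 <= rnorm v.
Proof. by rewrite -lecR rnormE; exact: normr_ge0. Qed.

Lemma rnorm0 : rnorm 0 = 0.
Proof. by rewrite /rnorm normr0. Qed.

Lemma ler_rnormD u v : rnorm (u + v) <= rnorm u + rnorm v.
Proof. by rewrite -lecR rmorphD /= !rnormE ler_normD. Qed.

Lemma rnormZ (a : R[i]) v : rnorm (a *: v) = complex.Re `|a| * rnorm v.
Proof.
apply: (@complexI R); rewrite rmorphM /= !rnormE normrZ.
by congr (_ * _); rewrite normc_def.
Qed.

Lemma ler_dist_rnorm u v : `|rnorm u - rnorm v| <= rnorm (u - v).
Proof.
rewrite ler_norml lerBlDr lerNl opprB lerBlDr; apply/andP; split.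
  rewrite [rnorm (u - v)](_ : _ = rnorm (v - u)); last by rewrite /rnorm distrC.
  by rewrite (le_trans _ (ler_rnormD _ _))// subrK.
by rewrite (le_trans _ (ler_rnormD _ _))// subrK.
Qed.

Lemma cvg_rnorm (u : E ^nat) (v : E) :
  u @ \oo --> v -> (rnorm \o u) @ \oo --> rnorm v.
Proof.
move=> /cvgrPdist_lt uv; apply/cvgrPdist_lt => e e0.
have eC0 : (0 : R[i]) < e%:C by rewrite ltcR.
near=> n; apply: (le_lt_trans (ler_dist_rnorm _ _)).
by rewrite -ltcR rnormE; near: n; exact: uv.
Unshelve. all: by end_near. Qed.

End real_norm.

Section bochner.
Context d (T : measurableType d) (R : realType).
Variables (mu : {finite_measure set T -> \bar R}) (E : normedModType R[i]).
Implicit Types (f g : T -> E).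

Definition simple_fun f :=
  finite_set (range f) /\ forall v, measurable (f @^-1` [set v]).

(* meant for a simple [f], whose range is finite *)
Definition simple_integral f : E :=
  \sum_(v \in range f) (fine (mu (f @^-1` [set v])))%:C *: v.

(* Everywhere, rather than almost everywhere, limits of simple functions: every
   a.e. class of a.e.-limits contains such a function, so [L2] is unaffected,
   and [rnorm \o f] is then Borel measurable. *)
Definition strongly_measurable f := exists f_ : (T -> E)^nat,
  (forall n, simple_fun (f_ n)) /\ forall x, f_ n x @[n --> \oo] --> f x.

Definition has_bochner_integral f (v : E) :=
  strongly_measurable f /\ exists f_ : (T -> E)^nat,
  [/\ forall n, simple_fun (f_ n),
      (\int[mu]_x (rnorm (f x - f_ n x))%:E)%E @[n --> \oo] --> (0 : \bar R)
    & simple_integral (f_ n) @[n --> \oo] --> v].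

(* 0 when [f] is not Bochner integrable *)
Definition bochner_integral f : E := xget 0 (has_bochner_integral f).

Definition square_integrable f :=
  strongly_measurable f /\ (\int[mu]_x ((rnorm (f x)) ^+ 2)%:E < +oo)%E.

Lemma measurable_simple_fun_preimage f (A : set E) :
  simple_fun f -> measurable (f @^-1` A).
Proof.
move=> [ff mf].
have -> : f @^-1` A = \bigcup_(v in range f `&` A) (f @^-1` [set v]).
  apply/seteqP; split => [x Afx|x [v [_ Av] /= fxv]]; last by rewrite /= fxv.
  by exists (f x) => //; split => //; exists x.
by apply: fin_bigcup_measurable => //; exact: finite_setIl.
Qed.

Lemma simple_fun_cst v : simple_fun (cst v).
Proof.
split=> [|w]; first exact: finite_image_cst.
by rewrite preimage_cst; case: ifPn.
Qed.

Lemma simple_funZD (a : R[i]) f g :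
  simple_fun f -> simple_fun g -> simple_fun (a *: f + g).
Proof.
move=> sf sg; split.
  apply: (@sub_finite_set _ _ [set a *: u + v | u in range f & v in range g]).
    by move=> _ [x _ <-]; exists (f x); [exists x|exists (g x) => //; exists x].
  by apply: finite_image2; [exact: sf.1|exact: sg.1].
move=> w.
have -> : (a *: f + g) @^-1` [set w] =
    \bigcup_(u in range f) (f @^-1` [set u] `&` g @^-1` [set w - a *: u]).
  apply/seteqP; split => [x /= <-|x [u _ [/= <- gx]]].
    by exists (f x); [exists x|split => //=; rewrite addrAC subrr add0r].
  by rewrite /= [LHS](_ : _ = a *: f x + g x)// gx addrC subrK.
apply: fin_bigcup_measurable; first exact: sf.1.
by move=> u _; apply: measurableI; [exact: sf.2|exact: sg.2].
Qed.

Lemma strongly_measurableZD (a : R[i]) f g :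
  strongly_measurable f -> strongly_measurable g ->
  strongly_measurable (a *: f + g).
Proof.
move=> [f_ [sf cf]] [g_ [sg cg]]; exists (fun n => a *: f_ n + g_ n); split.
  by move=> n; exact: simple_funZD.
by move=> x; apply: cvgD => //; apply: cvgZl_tmp; exact: cf.
Qed.

Lemma measurable_rnorm f :
  strongly_measurable f -> measurable_fun setT (fun x => rnorm (f x)).
Proof.
move=> [f_ [sf cf]].
apply: (@measurable_fun_cvg _ _ _ _ (fun n x => rnorm (f_ n x))).
  move=> n _ Y mY; rewrite setTI.
  exact: (measurable_simple_fun_preimage (@rnorm R E @^-1` Y)).
by move=> x _; exact: cvg_rnorm (cf x).
Qed.

Lemma measurable_rnorm_sqr f : strongly_measurable f ->
  measurable_fun setT (fun x => ((rnorm (f x)) ^+ 2)%:E).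
Proof.
by move=> mf; apply/measurable_EFinP; apply: measurable_funX;
  exact: measurable_rnorm.
Qed.

Lemma square_integrable0 : square_integrable 0.
Proof.
split.
  exists (fun=> 0); split; last by move=> x; exact: cvg_cst.
  by move=> n; exact: simple_fun_cst.
rewrite (eq_integral (cst 0%E)) ?integral0// => x _.
by rewrite [X in rnorm X](_ : _ = 0)// rnorm0 expr0n.
Qed.

Lemma square_integrableZD (a : R[i]) f g :
  square_integrable f -> square_integrable g -> square_integrable (a *: f + g).
Proof.
move=> [mf fi] [mg gi]; split; first exact: strongly_measurableZD.
pose c := complex.Re `|a|.
have c0 : 0 <= c by rewrite /c normc_def sqrtr_ge0.
apply: (@le_lt_trans _ _ (\int[mu]_x ((2 * c ^+ 2)%:E * ((rnorm (f x)) ^+ 2)%:E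
    + 2%:E * ((rnorm (g x)) ^+ 2)%:E))%E).
  apply: ge0_le_integral => //.
  - by move=> x _; rewrite lee_fin sqr_ge0.
  - by apply: measurable_rnorm_sqr; exact: strongly_measurableZD.
  - by apply: emeasurable_funD; apply: measurable_funeM;
      exact: measurable_rnorm_sqr.
  move=> x _; rewrite -!EFinM -EFinD lee_fin.
  have := ler_rnormD (a *: f x) (g x); rewrite rnormZ -/c => h.
  apply: (@le_trans _ _ ((c * rnorm (f x) + rnorm (g x)) ^+ 2)).
    by rewrite ler_sqr ?nnegrE ?rnorm_ge0 ?addr_ge0 ?mulr_ge0 ?rnorm_ge0.
  rewrite -subr_ge0 (_ : _ - _ = (c * rnorm (f x) - rnorm (g x)) ^+ 2).
    exact: sqr_ge0.
  by ring.
have IZ (k : R) (h : T -> E) : 0 <= k -> strongly_measurable h ->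
    (\int[mu]_x (k%:E * ((rnorm (h x)) ^+ 2)%:E) =
     k%:E * \int[mu]_x ((rnorm (h x)) ^+ 2)%:E)%E.
  move=> k0 mh; apply: ge0_integralZl => //; first exact: measurable_rnorm_sqr.
  by move=> x _; rewrite lee_fin sqr_ge0.
have IM (k : R) (h : T -> E) : strongly_measurable h ->
    measurable_fun setT (fun x => k%:E * ((rnorm (h x)) ^+ 2)%:E)%E.
  by move=> mh; apply: measurable_funeM; exact: measurable_rnorm_sqr.
have Ige0 (k : R) (h : T -> E) x : 0 <= k ->
    (0 <= k%:E * ((rnorm (h x)) ^+ 2)%:E)%E.
  by move=> k0; rewrite -EFinM lee_fin mulr_ge0// sqr_ge0.
have c20 : 0 <= 2 * c ^+ 2 by rewrite mulr_ge0// sqr_ge0.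
rewrite (ge0_integralD _ measurableT (fun x _ => Ige0 _ f x c20) (IM _ _ mf)
  (fun x _ => Ige0 _ g x (ler0n _ 2)) (IM _ _ mg)).
rewrite !IZ// lte_add_pinfty// lte_mul_pinfty// ?lee_fin//.
Qed.

Lemma bochner_integral_ae_eq f g : strongly_measurable f ->
  strongly_measurable g -> {ae mu, forall x, f x = g x} ->
  bochner_integral f = bochner_integral g.
Proof.
move=> mf mg fg; congr (xget 0 _); apply/funext => v; apply/propext.
have I h1 h2 h_ : strongly_measurable h1 -> strongly_measurable h2 ->
    simple_fun h_ -> {ae mu, forall x, h1 x = h2 x} ->
    (\int[mu]_x (rnorm (h1 x - h_ x))%:E = \int[mu]_x (rnorm (h2 x - h_ x))%:E)%E.
  move=> m1 m2 mh h12.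
  have mB h : strongly_measurable h ->
      measurable_fun setT (fun x => (rnorm (h x - h_ x))%:E).
    move=> sh; apply/measurable_EFinP.
    apply: (@measurable_rnorm (h - h_)); rewrite addrC -scaleN1r.
    apply: strongly_measurableZD => //; exists (fun=> h_); split => // x.
    exact: cvg_cst.
  apply: ae_eq_integral => //; [exact: mB|exact: mB|].
  by apply: filterS h12 => x -> _.
split=> -[_ [f_ [sf If Sf]]]; split=> //; exists f_; split => //.
  by under eq_fun do rewrite -(I f g)//.
by under eq_fun do rewrite (I f g)//.
Qed.

Definition square_integrable_pred : {pred T -> E} :=
  fun f => `[< square_integrable f >].

Lemma square_integrable_submod_closed : submod_closed square_integrable_pred.
Proof.
split=> [|a f g /asboolP sf /asboolP sg]; apply/asboolP.
  exact: square_integrable0.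
exact: square_integrableZD.
Qed.

HB.instance Definition _ := GRing.isSubmodClosed.Build _ _
  square_integrable_pred square_integrable_submod_closed.

Record L2fun := MkL2fun {
  L2fun_val :> T -> E ;
  L2fun_valP : L2fun_val \in square_integrable_pred
}.

HB.instance Definition _ := [isSub for L2fun_val].
HB.instance Definition _ := [Choice of L2fun by <:].
HB.instance Definition _ := [SubChoice_isSubLmodule of L2fun by <:].

Lemma L2funZDE (a : R[i]) (f g : L2fun) (x : T) :
  (a *: f + g) x = a *: f x + g x.
Proof. by []. Qed.

Lemma L2funBE (f g : L2fun) (x : T) : (f - g) x = f x - g x.
Proof. by []. Qed.

Lemma L2funZE (a : R[i]) (f : L2fun) (x : T) : (a *: f) x = a *: f x.
Proof. by []. Qed.

Definition ae_null : {pred L2fun} :=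
  fun h => `[< {ae mu, forall x, (h : L2fun) x = 0} >].

Lemma ae_null_submod_closed : submod_closed ae_null.
Proof.
split=> [|a f g /asboolP f0 /asboolP g0]; apply/asboolP.
  by apply: filterE.
by apply: filterS2 f0 g0 => x f0 g0; rewrite L2funZDE f0 g0 scaler0 addr0.
Qed.

HB.instance Definition _ := GRing.isSubmodClosed.Build _ _
  ae_null ae_null_submod_closed.

(* [L2fun] modulo [ae_null] *)
Definition L2 : Type := Quotient.quot ae_null.
HB.instance Definition _ := GRing.Zmodule.on L2.
HB.instance Definition _ := EqQuotient.on L2.

Local Open Scope quotient_scope.

Lemma L2_eqP (f g : L2fun) :
  \pi_L2 f = \pi_L2 g <-> {ae mu, forall x, f x = g x}.
Proof.
have -> : (\pi_L2 f = \pi_L2 g) = (f - g \in ae_null).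
  by rewrite Quotient.idealrBE; apply/propext; split => /eqP.
split=> [/asboolP fg|fg]; last apply/asboolP.
  by apply: filterS fg => x; rewrite L2funBE => /eqP; rewrite subr_eq0 => /eqP.
by apply: filterS fg => x fgx; rewrite L2funBE fgx subrr.
Qed.

Definition L2_scale (a : R[i]) (u : L2) : L2 := \pi_L2 (a *: repr u).

Lemma pi_L2_scale a (f : L2fun) : L2_scale a (\pi_L2 f) = \pi_L2 (a *: f).
Proof.
apply/L2_eqP; have /L2_eqP := reprK (\pi_L2 f).
by apply: filterS => x fx; rewrite !L2funZE fx.
Qed.

Lemma L2_surj (u : L2) : exists f : L2fun, u = \pi_L2 f.
Proof. by exists (repr u); rewrite reprK. Qed.

Lemma pi_L2D (f g : L2fun) : \pi_L2 (f + g) = \pi_L2 f + \pi_L2 g.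
Proof. exact: Quotient.pi_add. Qed.

Lemma L2_scaleA a b u : L2_scale a (L2_scale b u) = L2_scale (a * b) u.
Proof. by have [f ->] := L2_surj u; rewrite !pi_L2_scale scalerA. Qed.

Lemma L2_scale1 : left_id 1 L2_scale.
Proof. by move=> u; have [f ->] := L2_surj u; rewrite pi_L2_scale scale1r. Qed.

Lemma L2_scaleDr : right_distributive L2_scale +%R.
Proof.
move=> a u v; have [f ->] := L2_surj u; have [g ->] := L2_surj v.
by rewrite -pi_L2D !pi_L2_scale -pi_L2D scalerDr.
Qed.

Lemma L2_scaleDl u : {morph L2_scale^~ u : a b / a + b}.
Proof.
move=> a b; have [f ->] := L2_surj u.
by rewrite !pi_L2_scale -pi_L2D scalerDl.
Qed.

HB.instance Definition _ := GRing.Zmodule_isLmodule.Build R[i] L2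
  L2_scaleA L2_scale1 L2_scaleDr L2_scaleDl.

End bochner.

Section sobolev.
Variables (R : realType) (G : topologicalGroupType).
Variables (mu : probability (borel G) R) (E : normedModType R[i]).

(* The integral does not depend on the representative of the class [f], by
   [bochner_integral_ae_eq]. *)
Definition fourier (f : L2 mu E) (rho : unirrep R G) (u v : rep_space rho) : E :=
  bochner_integral mu (fun x : borel G =>
    rep_dot rho (adjoint (rep_dot rho) (rho x) u) v *: (repr f : L2fun mu E) x).

Variables (Ghat : unitary_dual R G).
Variable xi : forall sigma : Ghat,
  (rep_dim (dual_rep sigma)).-tuple (rep_space (dual_rep sigma)).
Variable gamma : Ghat -> R.

Definition sobolev_norm (s : R) (f : L2 mu E) : \bar R :=
  ((\esum_(sigma in [set: Ghat])
     ((rep_dim (dual_rep sigma))%:R * (1 + gamma sigma ^+ 2) `^ s *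
      \sum_(i < rep_dim (dual_rep sigma)) \sum_(j < rep_dim (dual_rep sigma))
        rnorm (fourier f (tnth (xi sigma) j) (tnth (xi sigma) i)) ^+ 2)%:E)
   `^ 2^-1)%E.

Definition sobolev (s : R) : set (L2 mu E) :=
  [set f | (sobolev_norm s f < +oo)%E].

End sobolev.

(* Continuity of the inclusion of [X] in [Y], for the distances
   [nX (g - f)] and [nY (g - f)]. *)
Definition continuously_embedded (R : realType) (V : zmodType) (X Y : set V)
    (nX nY : V -> \bar R) :=
  X `<=` Y /\
  forall f, X f -> forall e : R, 0 < e -> exists2 d : R, 0 < d &
    forall g, X g -> (nX (g - f)%R < d%:E)%E -> (nY (g - f)%R < e%:E)%E.

(* Main.v *)
Require Import Defs.
From HB Require Import structures.
From mathcomp Require Import all_boot all_order all_algebra.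
From mathcomp Require Import sesquilinear complex.
From mathcomp Require Import all_classical all_reals all_analysis.

Set Implicit Arguments.
Unset Strict Implicit.
Unset Printing Implicit Defensive.
Import Order.TTheory GRing.Theory Num.Theory.
Import numFieldNormedType.Exports.
Local Open Scope classical_set_scope.
Local Open Scope ring_scope.
Local Open Scope complex_scope.

(** Their base is at least 1, so each weight grows with the exponent, while the factors it
    multiplies are nonnegative and do not depend on it. Comparing the two series term by term and
    taking square roots gives the norm inequality in [[0, +oo]], for every [f] in [L2]. Both the
    inclusion of the spaces and its continuity follow from this inequality. *)

Lemma le_sobolev_norm (R : realType) (G : topologicalGroupType)
    (mu : probability (borel G) R) (E : normedModType R[i])
    (Ghat : unitary_dual R G)
    (xi : forall sigma : Ghat,
      (rep_dim (dual_rep sigma)).-tuple (rep_space (dual_rep sigma)))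
    (gamma : Ghat -> R) (s t : R) (f : L2 mu E) :
  s <= t -> (sobolev_norm xi gamma s f <= sobolev_norm xi gamma t f)%E.
Proof.
move=> le_st.
have sum_ge0 sigma : 0 <= \sum_(i < rep_dim (dual_rep sigma))
    \sum_(j < rep_dim (dual_rep sigma))
    rnorm (fourier f (tnth (xi sigma) j) (tnth (xi sigma) i)) ^+ 2.
  by apply: sumr_ge0 => i _; apply: sumr_ge0 => j _; exact: sqr_ge0.
have term_ge0 r sigma : (0 <= ((rep_dim (dual_rep sigma))%:R *
    (1 + gamma sigma ^+ 2) `^ r * \sum_(i < rep_dim (dual_rep sigma))
    \sum_(j < rep_dim (dual_rep sigma))
    rnorm (fourier f (tnth (xi sigma) j) (tnth (xi sigma) i)) ^+ 2)%:E)%E.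
  by rewrite lee_fin mulr_ge0// mulr_ge0// powR_ge0.
(* The outer power [2^-1] is monotone on [[0, +oo]]; both sums lie there by [term_ge0], so it
   remains to compare the sums. *)
apply: gt0_ler_poweR.
- by rewrite invr_ge0.
- by rewrite in_itv/= leey andbT esum_ge0.
- by rewrite in_itv/= leey andbT esum_ge0.
apply: le_esum => sigma _; rewrite lee_fin ler_wpM2r// ler_wpM2l//.
(* A real power increases with its exponent once the base is at least 1, which holds here because a
   square is added to 1. *)
by rewrite ler_powR// lerDl sqr_ge0.
Qed.

Theorem theorem3p2 (R : realType) (G : topologicalGroupType)
    (Gcompact : compact [set: G]) (Ghausdorff : hausdorff_space G)
    (mu : probability (borel G) R) (mu_haar : is_haar mu)
    (E : completeNormedModType R[i])
    (Ghat : unitary_dual R G)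
    (xi : forall sigma : Ghat,
      (rep_dim (dual_rep sigma)).-tuple (rep_space (dual_rep sigma)))
    (xi_basis : forall sigma : Ghat, basis_of fullv (xi sigma))
    (xi_orthonormal : forall sigma : Ghat,
      orthonormal (rep_dot (dual_rep sigma)) (xi sigma))
    (gamma : Ghat -> R) (gamma_ge0 : forall sigma, 0 <= gamma sigma)
    (s t : R) (s_ge0 : 0 <= s) (t_ge0 : 0 <= t) (lt_st : s < t) :
  continuously_embedded
    (sobolev (mu := mu) (E := E) xi gamma t)
    (sobolev (mu := mu) (E := E) xi gamma s)
    (sobolev_norm (mu := mu) (E := E) xi gamma t)
    (sobolev_norm (mu := mu) (E := E) xi gamma s) /\
  forall f : L2 mu E, sobolev xi gamma t f ->
    (sobolev_norm xi gamma s f <= sobolev_norm xi gamma t f)%E.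
Proof.
have le_norm f : (sobolev_norm xi gamma s f <= sobolev_norm xi gamma t f)%E.
  exact/le_sobolev_norm/ltW.
split=> //; split=> [f|f _ e e_gt0]; first exact: le_lt_trans.
(* The inclusion does not increase norms, so [d = e] works: [le_norm] is applied to the difference
   [g - f]. *)
by exists e => // g _; exact: le_lt_trans.
Qed.
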